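(* Let $\Bbbk$ be a field and let $\mathcal{C}$ be a $\Bbbk$-linear rigid monoidal category with the following two properties: (Ex1) for all $U,V\in\mathcal{C}$ the tensor product produces an injective $\Bbbk$-linear map $\mathcal{C}(\mathbf 1,V)\otimes_\Bbbk\mathcal{C}(U,\mathbf 1)\hookrightarrow\mathcal{C}(U,V)$; (Ex2) whenever a non-zero tensor product $f\otimes g$ of morphisms in $\mathcal{C}$ factors through $\mathbf 1$, then both $f$ and $g$ are a sum of morphisms factoring through $\mathbf 1$. Then $\mathcal{U}(\mathcal{C})=\mathcal{U}^{\mathrm{ex}}(\mathcal{C})$. In particular, in any pseudo-diagrammatic or $\oplus$-pseudo-diagrammatic category $\mathcal{C}$ that is rigid, one has $\mathcal{U}(\mathcal{C})=\mathcal{U}^{\mathrm{ex}}(\mathcal{C})$.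
   Context: Rigid means that every object has a left and a right dual. $\mathbf 1$ is the tensor unit; an object also denotes its identity morphism, and identifications $\mathbf 1\otimes U\cong U\cong U\otimes\mathbf 1$ are suppressed. $\mathcal{U}(\mathcal{C})$ is the collection of all non-zero morphisms $u\in\mathcal{C}(U,\mathbf 1)$, $U\in\mathcal{C}$; $\mathcal{U}^{\mathrm{ex}}(\mathcal{C})$ is the subcollection of those $u\colon U\to\mathbf 1$ which are a coequalizer of $u\otimes U$ and $U\otimes u\colon U\otimes U\to U$, i.e. a cokernel of $u\otimes U-U\otimes u$. A pseudo-diagrammatic category is a $\Bbbk$-linear monoidal category $\mathcal{C}$ for which there are bases $B_{U,V}$ of the hom-spaces $\mathcal{C}(U,V)$, for all $U,V$, such that (a) the tensor product restricts to an injective map $B_{U,V}\times B_{U',V'}\hookrightarrow B_{U\otimes U',V\otimes V'}$ for all $U,U',V,V'$, and (b) whenever $b\otimes b'$ factors through $\mathbf 1$ for basis elements $b,b'$, then both $b$ and $b'$ factor through $\mathbf 1$. An $\oplus$-pseudo-diagrammatic category is a $\Bbbk$-linear monoidal category which has a full $\Bbbk$-linear monoidal subcategory $\mathcal{C}_0$ that is pseudo-diagrammatic and such that any object of $\mathcal{C}$ is a direct summand of a finite direct sum of objects of $\mathcal{C}_0$. *)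

(* Defs.v *)
From mathcomp Require Import all_boot all_order all_algebra.
Set Implicit Arguments.
Unset Strict Implicit.
Unset Printing Implicit Defensive.
Import GRing.Theory.
Local Open Scope ring_scope.

Section LinearAlgebra.
Variable k : fieldType.

Definition bilinear_map (A B W : lmodType k) (b : A -> B -> W) : Prop :=
  (forall x, linear (fun y => b x y)) /\ (forall y, linear (fun x => b x y)).

(* [T], with [t x y] as pure tensors, is a tensor product of [A] and [B]
   over [k]. *)
Definition is_tensor_product (A B T : lmodType k) (t : A -> B -> T) : Prop :=
  bilinear_map t /\
  forall (W : lmodType k) (b : A -> B -> W), bilinear_map b ->
    exists phi : T -> W,
      [/\ linear phi,
          forall x y, phi (t x y) = b x y
        & forall psi : T -> W, linear psi ->
            (forall x y, psi (t x y) = b x y) -> psi =1 phi].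

(* The linear map out of the tensor product of [A] and [B] that is induced by
   the bilinear map [b] is injective. *)
Definition tensor_injective (A B W : lmodType k) (b : A -> B -> W) : Prop :=
  exists (T : lmodType k) (t : A -> B -> T) (phi : T -> W),
    [/\ is_tensor_product t,
        linear phi,
        forall x y, phi (t x y) = b x y
      & injective phi].

(* Bases of vector spaces of arbitrary dimension, as sets of vectors. *)
Definition is_basis (M : lmodType k) (B : M -> Prop) : Prop :=
  (forall (n : nat) (e : 'I_n -> M) (c : 'I_n -> k),
      injective e -> (forall i, B (e i)) ->
      \sum_i c i *: e i = 0 -> forall i, c i = 0) /\
  (forall m : M, exists (n : nat) (e : 'I_n -> M) (c : 'I_n -> k),
      (forall i, B (e i)) /\ m = \sum_i c i *: e i).

End LinearAlgebra.

Record linCat (k : fieldType) := LinCat {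
  Ob :> Type;
  Hom : Ob -> Ob -> lmodType k;
  idm : forall X, Hom X X;
  comp : forall X Y Z, Hom Y Z -> Hom X Y -> Hom X Z;
  compA : forall W X Y Z (h : Hom Y Z) (g : Hom X Y) (f : Hom W X),
    comp h (comp g f) = comp (comp h g) f;
  comp_idl : forall X Y (f : Hom X Y), comp (idm Y) f = f;
  comp_idr : forall X Y (f : Hom X Y), comp f (idm X) = f;
  comp_bilinear : forall X Y Z, bilinear_map (@comp X Y Z)
}.
Arguments Hom {k} {l} X Y.
Arguments idm {k} {l} X.
Arguments comp {k} {l} {X Y Z} g f.

Notation "g ∘ f" := (comp g f) (at level 40, left associativity).

Record monCat (k : fieldType) := MonCat {
  moncat_lin :> linCat k;
  tunit : moncat_lin;
  tens : moncat_lin -> moncat_lin -> moncat_lin;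
  tensm : forall X Y X' Y' : moncat_lin,
    Hom X Y -> Hom X' Y' -> Hom (tens X X') (tens Y Y');
  tensm_id : forall X Y, tensm (idm X) (idm Y) = idm (tens X Y);
  tensm_comp : forall X Y Z X' Y' Z'
      (g : Hom Y Z) (f : Hom X Y) (g' : Hom Y' Z') (f' : Hom X' Y'),
    tensm (g ∘ f) (g' ∘ f') = tensm g g' ∘ tensm f f';
  tensm_bilinear : forall X Y X' Y', bilinear_map (@tensm X Y X' Y');
  assoc : forall X Y Z, Hom (tens (tens X Y) Z) (tens X (tens Y Z));
  assoc_inv : forall X Y Z, Hom (tens X (tens Y Z)) (tens (tens X Y) Z);
  assocK : forall X Y Z, assoc_inv X Y Z ∘ assoc X Y Z = idm _;
  assoc_invK : forall X Y Z, assoc X Y Z ∘ assoc_inv X Y Z = idm _;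
  assoc_nat : forall X Y Z X' Y' Z'
      (f : Hom X X') (g : Hom Y Y') (h : Hom Z Z'),
    assoc X' Y' Z' ∘ tensm (tensm f g) h = tensm f (tensm g h) ∘ assoc X Y Z;
  lunit : forall X, Hom (tens tunit X) X;
  lunit_inv : forall X, Hom X (tens tunit X);
  lunitK : forall X, lunit_inv X ∘ lunit X = idm _;
  lunit_invK : forall X, lunit X ∘ lunit_inv X = idm _;
  lunit_nat : forall X Y (f : Hom X Y),
    lunit Y ∘ tensm (idm tunit) f = f ∘ lunit X;
  runit : forall X, Hom (tens X tunit) X;
  runit_inv : forall X, Hom X (tens X tunit);
  runitK : forall X, runit_inv X ∘ runit X = idm _;
  runit_invK : forall X, runit X ∘ runit_inv X = idm _;
  runit_nat : forall X Y (f : Hom X Y),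
    runit Y ∘ tensm f (idm tunit) = f ∘ runit X;
  pentagon : forall W X Y Z,
    assoc W X (tens Y Z) ∘ assoc (tens W X) Y Z =
    tensm (idm W) (assoc X Y Z) ∘ assoc W (tens X Y) Z
      ∘ tensm (assoc W X Y) (idm Z);
  triangle : forall X Y,
    tensm (idm X) (lunit Y) ∘ assoc X tunit Y = tensm (runit X) (idm Y)
}.
Arguments tunit {k} m.
Arguments tens {k} {m} X Y.
Arguments tensm {k} {m} {X Y X' Y'} f g.
Arguments assoc {k} {m} X Y Z.
Arguments assoc_inv {k} {m} X Y Z.
Arguments lunit {k} {m} X.
Arguments lunit_inv {k} {m} X.
Arguments runit {k} {m} X.
Arguments runit_inv {k} {m} X.

Notation "X ⊗₀ Y" := (tens X Y) (at level 39, left associativity).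
Notation "f ⊗₁ g" := (tensm f g) (at level 39, left associativity).
Notation "𝟙" := (tunit _).

Section MonoidalNotions.
Variables (k : fieldType) (C : monCat k).

Definition dual_pair (X Y : C) (ev : Hom (X ⊗₀ Y) 𝟙) (coev : Hom 𝟙 (Y ⊗₀ X))
  : Prop :=
  runit Y ∘ (idm Y ⊗₁ ev) ∘ assoc Y X Y ∘ (coev ⊗₁ idm Y) ∘ lunit_inv Y = idm Y
  /\
  lunit X ∘ (ev ⊗₁ idm X) ∘ assoc_inv X Y X ∘ (idm X ⊗₁ coev) ∘ runit_inv X
    = idm X.

Definition is_left_dual (X Y : C) : Prop := exists ev coev, @dual_pair X Y ev coev.

Definition rigid : Prop :=
  forall U : C, (exists X, is_left_dual X U) /\ (exists Y, is_left_dual U Y).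

Definition is_coequalizer (X Y Z : C) (f g : Hom X Y) (q : Hom Y Z) : Prop :=
  q ∘ f = q ∘ g /\
  forall (V : C) (v : Hom Y V), v ∘ f = v ∘ g -> exists! w : Hom Z V, w ∘ q = v.

Definition Ucoll (U : C) (u : Hom U 𝟙) : Prop := u != 0.

Definition Uex (U : C) (u : Hom U 𝟙) : Prop :=
  Ucoll u /\
  is_coequalizer (lunit U ∘ (u ⊗₁ idm U)) (runit U ∘ (idm U ⊗₁ u)) u.

Definition U_eq_Uex : Prop :=
  forall (U : C) (u : Hom U 𝟙), Ucoll u <-> Uex u.

Definition factors_through_unit (X Y : C) (f : Hom X Y) : Prop :=
  exists (p : Hom X 𝟙) (q : Hom 𝟙 Y), f = q ∘ p.

Definition sum_of_factors_through_unit (X Y : C) (f : Hom X Y) : Prop :=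
  exists (n : nat) (h : 'I_n -> Hom X Y),
    (forall i, factors_through_unit (h i)) /\ f = \sum_i h i.

Definition Ex1 : Prop :=
  forall U V : C,
    tensor_injective (fun (f : Hom 𝟙 V) (g : Hom U 𝟙) =>
                        runit V ∘ (f ⊗₁ g) ∘ lunit_inv U).

Definition Ex2 : Prop :=
  forall (U V U' V' : C) (f : Hom U V) (g : Hom U' V'),
    f ⊗₁ g != 0 -> factors_through_unit (f ⊗₁ g) ->
    sum_of_factors_through_unit f /\ sum_of_factors_through_unit g.

(* The unit isomorphisms, which identify [𝟙 ⊗₀ U], [U] and [U ⊗₀ 𝟙], identify
   the corresponding members of the family [B] of sets of morphisms. This is
   automatic when the unit isomorphisms are identities. *)
Definition unit_compatible (B : forall X Y : C, Hom X Y -> Prop) : Prop :=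
  forall (X Y : C) (f : Hom X Y),
    [/\ B _ _ f <-> B _ _ (f ∘ lunit X),
        B _ _ f <-> B _ _ (f ∘ runit X),
        B _ _ f <-> B _ _ (lunit_inv Y ∘ f)
      & B _ _ f <-> B _ _ (runit_inv Y ∘ f)].

Definition pseudo_diagrammatic : Prop :=
  exists B : forall X Y : C, Hom X Y -> Prop,
    [/\ forall X Y, is_basis (B X Y),
        unit_compatible B,
        forall (U V U' V' : C) (b : Hom U V) (b' : Hom U' V'),
          B _ _ b -> B _ _ b' -> B _ _ (b ⊗₁ b'),
        forall (U V U' V' : C) (b1 b2 : Hom U V) (b1' b2' : Hom U' V'),
          B _ _ b1 -> B _ _ b2 -> B _ _ b1' -> B _ _ b2' ->
          b1 ⊗₁ b1' = b2 ⊗₁ b2' -> b1 = b2 /\ b1' = b2'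
      & forall (U V U' V' : C) (b : Hom U V) (b' : Hom U' V'),
          B _ _ b -> B _ _ b' -> factors_through_unit (b ⊗₁ b') ->
          factors_through_unit b /\ factors_through_unit b'].

Definition is_direct_sum (I : finType) (X : I -> C) (S : C) : Prop :=
  exists (inj : forall i, Hom (X i) S) (pr : forall i, Hom S (X i)),
    [/\ forall i, pr i ∘ inj i = idm (X i),
        forall i j, i != j -> pr j ∘ inj i = 0
      & \sum_i (inj i ∘ pr i) = idm S].

Definition is_direct_summand (X S : C) : Prop :=
  exists Y : C, is_direct_sum (fun b : bool => if b then X else Y) S.

Section FullSubcategory.
Variables (P : C -> Prop) (P1 : P 𝟙)
  (Pt : forall X Y, P X -> P Y -> P (X ⊗₀ Y)).

Definition full_linear_subcat : linCat k :=
  @LinCat k {X : C | P X}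
    (fun X Y => Hom (sval X) (sval Y))
    (fun X => idm (sval X))
    (fun _ _ _ g f => g ∘ f)
    (fun _ _ _ _ h g f => compA h g f)
    (fun _ _ f => comp_idl f)
    (fun _ _ f => comp_idr f)
    (fun X Y Z => comp_bilinear (sval X) (sval Y) (sval Z)).

Definition full_monoidal_subcat : monCat k :=
  @MonCat k full_linear_subcat
    (exist P 𝟙 P1)
    (fun X Y => exist P (sval X ⊗₀ sval Y) (Pt (svalP X) (svalP Y)))
    (fun _ _ _ _ f g => f ⊗₁ g)
    (fun X Y => tensm_id (sval X) (sval Y))
    (fun _ _ _ _ _ _ g f g' f' => tensm_comp g f g' f')
    (fun X Y X' Y' => tensm_bilinear (sval X) (sval Y) (sval X') (sval Y'))
    (fun X Y Z => assoc (sval X) (sval Y) (sval Z))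
    (fun X Y Z => assoc_inv (sval X) (sval Y) (sval Z))
    (fun X Y Z => assocK (sval X) (sval Y) (sval Z))
    (fun X Y Z => assoc_invK (sval X) (sval Y) (sval Z))
    (fun _ _ _ _ _ _ f g h => assoc_nat f g h)
    (fun X => lunit (sval X))
    (fun X => lunit_inv (sval X))
    (fun X => lunitK (sval X))
    (fun X => lunit_invK (sval X))
    (fun _ _ f => lunit_nat f)
    (fun X => runit (sval X))
    (fun X => runit_inv (sval X))
    (fun X => runitK (sval X))
    (fun X => runit_invK (sval X))
    (fun _ _ f => runit_nat f)
    (fun W X Y Z => pentagon (sval W) (sval X) (sval Y) (sval Z))
    (fun X Y => triangle (sval X) (sval Y)).

End FullSubcategory.
End MonoidalNotions.

Arguments full_monoidal_subcat {k C} P P1 Pt.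

Definition oplus_pseudo_diagrammatic (k : fieldType) (C : monCat k) : Prop :=
  exists (P : C -> Prop) (P1 : P 𝟙)
         (Pt : forall X Y, P X -> P Y -> P (X ⊗₀ Y)),
    pseudo_diagrammatic (full_monoidal_subcat P P1 Pt) /\
    forall X : C, exists (n : nat) (Y : 'I_n -> C) (S : C),
      [/\ forall i, P (Y i), is_direct_sum Y S & is_direct_summand X S].

(* Main.v *)
(** Let [u : U -> 𝟙] be non-zero and let [v : U -> V] satisfy [u ⊗ v = v ⊗ u].
    Moving the left factor of [U ⊗ U] across the duality of [U] with [Y] turns
    this into [u* ⊗ v = q ∘ u], where [u* : 𝟙 -> Y] is the adjunct of [u] and
    [q] is essentially the adjunct of [v]. So [u* ⊗ v] factors through [𝟙], and
    it vanishes only if [v] does, because [q ∘ u = 0] forces [q = 0]. By (Ex2),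
    [v] is a sum of composites [q i ∘ p i]. Slicing the equation by a functional
    [δ] on [C(U, 𝟙)] with [δ u != 0], as (Ex1) permits, gives [q = u* ⊗ w] with
    [w = (δ u)^-1 *: \sum_i δ (p i) *: q i]. Hence [u* ⊗ (v - w ∘ u) = 0], and
    [v = w ∘ u].

    In the pseudo-diagrammatic case, the slicing and the splitting property are
    proved for the subcategory with bases, using [δ_(b ⊗ c) (f ⊗ g) = δ_b f * δ_c g]
    for coordinate functionals, and carried to direct summands of direct sums by
    composing with inclusions and projections. *)
Require Import Defs.
From HB Require Import structures.
From mathcomp Require Import all_boot all_order all_algebra.
From mathcomp Require Import boolp classical_sets.
Import Defs.
Set Implicit Arguments.
Unset Strict Implicit.
Unset Printing Implicit Defensive.
Import GRing.Theory.
Local Open Scope ring_scope.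

(** * Linear and bilinear maps given as plain functions *)

Section LinearMaps.
Variables (k : fieldType) (A B : lmodType k) (f : A -> B) (hf : linear f).
Let hf' := GRing.isLinear.Build k A B *:%R f hf.
Let fL : {linear A -> B} := HB.pack f hf'.

Lemma lin0 : f 0 = 0. Proof. exact: (linear0 fL). Qed.
Lemma linB x y : f (x - y) = f x - f y. Proof. exact: (linearB fL). Qed.
Lemma linZ a x : f (a *: x) = a *: f x. Proof. exact: (linearZ_LR fL). Qed.
Lemma linsum (I : Type) (r : seq I) (F : I -> A) :
  f (\sum_(i <- r) F i) = \sum_(i <- r) f (F i).
Proof. exact: (linear_sum fL). Qed.
End LinearMaps.

Section BilinearMaps.
Variables (k : fieldType) (A B W : lmodType k).
Variables (b : A -> B -> W) (hb : bilinear_map b).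

Lemma bil0l y : b 0 y = 0. Proof. exact: lin0 (proj2 hb y). Qed.
Lemma bil0r x : b x 0 = 0. Proof. exact: lin0 (proj1 hb x). Qed.
Lemma bilBl x x' y : b (x - x') y = b x y - b x' y.
Proof. exact: linB (proj2 hb y) x x'. Qed.
Lemma bilBr x y y' : b x (y - y') = b x y - b x y'.
Proof. exact: linB (proj1 hb x) y y'. Qed.
Lemma bilZl a x y : b (a *: x) y = a *: b x y.
Proof. exact: linZ (proj2 hb y) a x. Qed.
Lemma bilZr a x y : b x (a *: y) = a *: b x y.
Proof. exact: linZ (proj1 hb x) a y. Qed.
Lemma bilsuml (I : Type) (r : seq I) (F : I -> A) y :
  b (\sum_(i <- r) F i) y = \sum_(i <- r) b (F i) y.
Proof. exact: (linsum (proj2 hb y) r F). Qed.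
Lemma bilsumr (I : Type) (r : seq I) x (F : I -> B) :
  b x (\sum_(i <- r) F i) = \sum_(i <- r) b x (F i).
Proof. exact: (linsum (proj1 hb x) r F). Qed.

End BilinearMaps.

(** * Coherence of the unit isomorphisms, and adjuncts under duality *)

Section MonoidalCoherence.
Variables (k : fieldType) (C : monCat k).
Implicit Types X Y Z U V : C.

Lemma tensm_lr X Y X' Y' (f : Hom X Y) (g : Hom X' Y') :
  f ⊗₁ g = (f ⊗₁ idm Y') ∘ (idm X ⊗₁ g).
Proof. by rewrite -tensm_comp comp_idl comp_idr. Qed.

Lemma tensm_rl X Y X' Y' (f : Hom X Y) (g : Hom X' Y') :
  f ⊗₁ g = (idm Y ⊗₁ g) ∘ (f ⊗₁ idm X').
Proof. by rewrite -tensm_comp comp_idl comp_idr. Qed.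

Lemma tensm_compl X Y Z U (g : Hom Y Z) (f : Hom X Y) :
  (g ∘ f) ⊗₁ idm U = (g ⊗₁ idm U) ∘ (f ⊗₁ idm U).
Proof. by rewrite -tensm_comp comp_idl. Qed.

Lemma tensm_compr X Y Z U (g : Hom Y Z) (f : Hom X Y) :
  idm U ⊗₁ (g ∘ f) = (idm U ⊗₁ g) ∘ (idm U ⊗₁ f).
Proof. by rewrite -tensm_comp comp_idl. Qed.

Lemma assoc_inv_nat X Y Z X' Y' Z' (f : Hom X X') (g : Hom Y Y') (h : Hom Z Z') :
  assoc_inv X' Y' Z' ∘ (f ⊗₁ (g ⊗₁ h)) = ((f ⊗₁ g) ⊗₁ h) ∘ assoc_inv X Y Z.
Proof.
rewrite -[LHS]comp_idr -(assoc_invK X Y Z) !compA -(compA (assoc_inv _ _ _)).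
by rewrite -assoc_nat compA assocK comp_idl.
Qed.

Lemma lunit_inv_nat X Y (f : Hom X Y) :
  lunit_inv Y ∘ f = (idm 𝟙 ⊗₁ f) ∘ lunit_inv X.
Proof.
by rewrite -[LHS]comp_idr -(lunit_invK X) compA -(compA (lunit_inv _))
  -lunit_nat compA lunitK comp_idl.
Qed.

Lemma lunit_faithful X Y (f g : Hom X Y) :
  idm 𝟙 ⊗₁ f = idm 𝟙 ⊗₁ g -> f = g.
Proof.
by move=> e; rewrite -[f]comp_idr -[g]comp_idr -(lunit_invK X) !compA
  -!lunit_nat e.
Qed.

Lemma runit_faithful X Y (f g : Hom X Y) :
  f ⊗₁ idm 𝟙 = g ⊗₁ idm 𝟙 -> f = g.
Proof.
by move=> e; rewrite -[f]comp_idr -[g]comp_idr -(runit_invK X) !compA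
  -!runit_nat e.
Qed.

(** Naturality of [lunit] at [lunit X] itself, with the isomorphism [lunit X] cancelled on the
    left. *)
Lemma lunit_tunit X : lunit (tens 𝟙 X) = idm 𝟙 ⊗₁ lunit X.
Proof.
rewrite -[LHS]comp_idl -[RHS]comp_idl -(lunitK X) -!compA.
by rewrite lunit_nat.
Qed.

(* Pentagon at [(𝟙, 𝟙, X, Y)], with the triangle applied to both sides. *)
Lemma lunit_tens X Y : lunit X ⊗₁ idm Y = lunit (tens X Y) ∘ assoc 𝟙 X Y.
Proof.
apply: lunit_faithful; rewrite tensm_compr.
have e : assoc 𝟙 X Y ∘ ((runit 𝟙 ⊗₁ idm X) ⊗₁ idm Y)
    = (idm 𝟙 ⊗₁ lunit (tens X Y)) ∘ (idm 𝟙 ⊗₁ assoc 𝟙 X Y)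
       ∘ assoc 𝟙 (tens 𝟙 X) Y ∘ (assoc 𝟙 𝟙 X ⊗₁ idm Y).
  rewrite -(compA (idm 𝟙 ⊗₁ lunit (tens X Y))) -(compA (idm 𝟙 ⊗₁ lunit (tens X Y))).
  by rewrite -pentagon compA triangle assoc_nat tensm_id.
move: e; rewrite -triangle tensm_compl compA assoc_nat => e.
have {}e := congr1 (fun h => h ∘ (assoc_inv 𝟙 𝟙 X ⊗₁ idm Y)) e.
move: e; rewrite -!compA -tensm_compl assoc_invK tensm_id comp_idr => e.
have {}e := congr1 (fun h => h ∘ assoc_inv _ _ _) e.
by move: e; rewrite -!compA assoc_invK !comp_idr.
Qed.

(** After tensoring with [𝟙] on the right, [triangle] and [lunit_tens] express both sides through
    [assoc], and [lunit_tunit] matches them. *)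
Lemma lunit_runit : lunit (tunit C) = runit 𝟙.
Proof. by apply: runit_faithful; rewrite -triangle lunit_tens lunit_tunit. Qed.

(** Interchange splits [q ⊗ p] into [q ⊗ 𝟙] after [𝟙 ⊗ p], and both slide past the unit
    isomorphisms. So the map in [Ex1] is composition through [𝟙]. *)
Lemma comp_tunitE U V (q : Hom 𝟙 V) (p : Hom U 𝟙) :
  runit V ∘ (q ⊗₁ p) ∘ lunit_inv U = q ∘ p.
Proof.
rewrite tensm_lr compA runit_nat -!compA -lunit_inv_nat -lunit_runit.
by rewrite (compA (lunit 𝟙)) lunit_invK comp_idl.
Qed.

Definition balanced U V (u : Hom U 𝟙) (v : Hom U V) : Prop :=
  v ∘ (lunit U ∘ (u ⊗₁ idm U)) = v ∘ (runit U ∘ (idm U ⊗₁ u)).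

(** Naturality of the unit isomorphisms turns the condition on test morphisms in [Uex] into
    [u ⊗ v = v ⊗ u], to which duality applies. *)
Lemma balancedE U V (u : Hom U 𝟙) (v : Hom U V) :
  balanced u v <-> lunit V ∘ (u ⊗₁ v) = runit V ∘ (v ⊗₁ u).
Proof.
by rewrite /balanced !compA -lunit_nat -runit_nat -!compA -!tensm_comp
  !comp_idl !comp_idr.
Qed.

Lemma balanced_refl U (u : Hom U 𝟙) : balanced u u.
Proof. by apply/balancedE; rewrite lunit_runit. Qed.

(** The zigzag identity recovers [v] from its adjunct: by interchange [v] slides past [ev] and meets
    [coev]. *)
Lemma dual_adjunct_inj U Y ev coev V (v : Hom U V) :
  dual_pair (X:=U) (Y:=Y) ev coev -> (idm Y ⊗₁ v) ∘ coev = 0 -> v = 0.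
Proof.
case=> _ zz v0; rewrite -[v]comp_idr -zz !compA -lunit_nat.
rewrite -(compA (lunit V)) -tensm_rl tensm_lr.
rewrite -!compA (compA (idm (tens U Y) ⊗₁ v)) -[idm (tens U Y)]tensm_id.
rewrite -assoc_inv_nat -!compA (compA (idm U ⊗₁ _)) -tensm_compr v0.
rewrite (bil0r (tensm_bilinear _ _ _ _)).
by rewrite (bil0l (comp_bilinear _ _ _)) !(bil0r (comp_bilinear _ _ _)).
Qed.

End MonoidalCoherence.

(** * From slice maps to the coequalizer property *)

Section Slices.
Variables (k : fieldType) (C : monCat k).

(* Weak form of [Ex1]: enough functionals on [C(U,𝟙)] extend to slice maps
   [q ∘ p |-> δ p *: q] that are well defined on sums of composites. *)
Definition has_slices : Prop :=
  forall (U : C) (p : Hom U 𝟙), p != 0 ->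
    exists δ : Hom U 𝟙 -> k, δ p != 0 /\
      forall (V : C) (n : nat) (q : 'I_n -> Hom 𝟙 V) (r : 'I_n -> Hom U 𝟙),
        \sum_i q i ∘ r i = 0 -> \sum_i δ (r i) *: q i = 0.

Hypothesis slices : has_slices.

Lemma comp_tunit_eq0 (U V : C) (q : Hom 𝟙 V) (p : Hom U 𝟙) :
  p != 0 -> q ∘ p = 0 -> q = 0.
Proof.
move=> /slices [δ [δp h]] qp0.
have := h V 1 (fun=> q) (fun=> p); rewrite !big_ord1 => /(_ qp0) /eqP.
by rewrite scaler_eq0 (negbTE δp) => /eqP.
Qed.

Section Balanced.
Variables (U : C) (u : Hom U 𝟙) (u0 : u != 0).
Variables (Y : C) (ev : Hom (U ⊗₀ Y) 𝟙) (coev : Hom 𝟙 (Y ⊗₀ U)).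
Hypothesis dual : dual_pair ev coev.

Let ud : Hom 𝟙 Y := runit Y ∘ (idm Y ⊗₁ u) ∘ coev.

(* Both sides are the adjunct of [u ⊗ v = v ⊗ u] under the duality of [U]
   and [Y], applied to the left factor of [U ⊗ U]. *)
Lemma balanced_adjunct V (v : Hom U V) : balanced u v ->
  exists q, (ud ⊗₁ v) ∘ lunit_inv U = q ∘ u /\ (q = 0 -> v = 0).
Proof.
move=> /balancedE uv.
(* The adjunct of [v], kept tensored with [𝟙] so that a [u] acting on the right factor can be split
   off by interchange. *)
exists ((idm Y ⊗₁ runit V) ∘ assoc Y V 𝟙 ∘ (((idm Y ⊗₁ v) ∘ coev) ⊗₁ idm 𝟙)
         ∘ lunit_inv 𝟙); split; last first.
  move=> q0; apply: (dual_adjunct_inj dual).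
  apply: runit_faithful; rewrite (bil0l (tensm_bilinear _ _ _ _)).
  have /= {}q0 := congr1 (fun h => (idm Y ⊗₁ runit_inv V) ∘ h ∘ lunit 𝟙) q0.
  move: q0; rewrite (bil0r (comp_bilinear _ _ _)) (bil0l (comp_bilinear _ _ _)).
  rewrite -!compA lunitK comp_idr compA -tensm_compr runitK tensm_id comp_idl.
  move=> /(congr1 (fun h => assoc_inv _ _ _ ∘ h)).
  by rewrite compA assocK comp_idl (bil0r (comp_bilinear _ _ _)).
have <- : (idm Y ⊗₁ lunit V) ∘ (idm Y ⊗₁ (u ⊗₁ v)) ∘ assoc Y U U
     ∘ (coev ⊗₁ idm U) ∘ lunit_inv U = (ud ⊗₁ v) ∘ lunit_inv U.
  rewrite -(compA _ _ (assoc _ _ _)) -assoc_nat compA triangle.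
  by rewrite -!tensm_comp comp_idl comp_idr.
(* Once [u ⊗ v] is exchanged for [v ⊗ u], duality acts on [v] while [u] acts on the remaining
   factor. *)
rewrite -tensm_compr uv tensm_compr -(compA _ _ (assoc _ _ _)) -assoc_nat.
rewrite -!compA lunit_inv_nat (compA (_ ⊗₁ _) (coev ⊗₁ _)) -tensm_comp comp_idr.
by rewrite [_ ⊗₁ u]tensm_lr -!compA.
Qed.

Lemma balanced_eq0 V (v : Hom U V) : balanced u v -> ud ⊗₁ v = 0 -> v = 0.
Proof.
move=> /balanced_adjunct[q [e q0]] v0; apply: q0.
apply: (comp_tunit_eq0 u0); rewrite -e v0.
by rewrite (bil0l (comp_bilinear _ _ _)).
Qed.

Lemma balanced_sum_factors V n (q : 'I_n -> Hom 𝟙 V) (p : 'I_n -> Hom U 𝟙) :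
  balanced u (\sum_i q i ∘ p i) -> exists w, \sum_i q i ∘ p i = w ∘ u.
Proof.
set v := \sum_i _ => uv; have [z [e _]] := balanced_adjunct uv.
have [δ [δu hδ]] := slices u0.
pose w := (δ u)^-1 *: \sum_i δ (p i) *: q i.
pose Q := fun x : Hom 𝟙 V => (ud ⊗₁ x) ∘ lunit_inv 𝟙.
have QE x (r : Hom U 𝟙) : Q x ∘ r = (ud ⊗₁ (x ∘ r)) ∘ lunit_inv U.
  by rewrite /Q -compA lunit_inv_nat compA -tensm_comp comp_idr.
have zE : z = Q w.
  (* Slices apply to vanishing sums of composites, so [z ∘ u = \sum_i Q (q i) ∘ p i] becomes one
     such sum with [- z] and [u] at [ord0]. *)
  pose q' (i : 'I_n.+1) := if unlift ord0 i is Some j then Q (q j) else - z.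
  pose p' (i : 'I_n.+1) := if unlift ord0 i is Some j then p j else u.
  have q'0 : q' ord0 = - z by rewrite /q' unlift_none.
  have q'S j : q' (lift ord0 j) = Q (q j) by rewrite /q' liftK.
  have p'0 : p' ord0 = u by rewrite /p' unlift_none.
  have p'S j : p' (lift ord0 j) = p j by rewrite /p' liftK.
  have /hδ : \sum_i q' i ∘ p' i = 0.
    rewrite big_ord_recl q'0 p'0 -[- z]sub0r (bilBl (comp_bilinear _ _ _)).
    rewrite (bil0l (comp_bilinear _ _ _)) sub0r addrC; apply/eqP.
    rewrite subr_eq0 -e /v; apply/eqP.
    rewrite (bilsumr (tensm_bilinear _ _ _ _)) (bilsuml (comp_bilinear _ _ _)).
    by apply: eq_bigr => i _; rewrite q'S p'S QE.
  rewrite big_ord_recl q'0 p'0 scalerN addrC => /eqP.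
  rewrite subr_eq0 => /eqP zE.
  rewrite -[z]scale1r -(mulVf δu) -scalerA -zE /Q /w.
  rewrite (bilZr (tensm_bilinear _ _ _ _)) (bilZl (comp_bilinear _ _ _)).
  rewrite (bilsumr (tensm_bilinear _ _ _ _)) (bilsuml (comp_bilinear _ _ _)).
  congr (_ *: _); apply: eq_bigr => i _; rewrite q'S p'S /Q.
  by rewrite (bilZr (tensm_bilinear _ _ _ _)) (bilZl (comp_bilinear _ _ _)).
(* The difference [v - w ∘ u] is again balanced, and [z = Q w] makes its tensor product with [ud]
   vanish. *)
exists w; apply/eqP; rewrite -subr_eq0; apply/eqP/balanced_eq0.
  rewrite /balanced !(bilBl (comp_bilinear _ _ _)) uv.
  by rewrite -!(compA w) (balanced_refl u).
rewrite (bilBr (tensm_bilinear _ _ _ _)); apply/eqP; rewrite subr_eq0; apply/eqP.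
have := e; rewrite zE QE => /(congr1 (fun h => h ∘ lunit U)).
by rewrite -!compA lunitK !comp_idr.
Qed.

End Balanced.

Hypothesis tens_split : forall (U V U' V' : C) (f : Hom U V) (g : Hom U' V'),
  f ⊗₁ g != 0 -> factors_through_unit (f ⊗₁ g) -> sum_of_factors_through_unit g.

Lemma U_eq_Uex_of_slices : rigid C -> U_eq_Uex C.
Proof.
move=> rC U u; split=> [u0|[]//]; split=> //; split; first exact: balanced_refl.
move=> V v uv; have [_ [Y [ev [coev dual]]]] := rC U.
have [w vE] : exists w, v = w ∘ u.
  have [->|v0] := eqVneq v 0.
    by exists 0; rewrite (bil0l (comp_bilinear _ _ _)).
  have [q [e q0]] := balanced_adjunct dual uv.
  have [||n [h [hf vE]]] :=
    tens_split (f := runit Y ∘ (idm Y ⊗₁ u) ∘ coev) (g := v).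
  - by apply: contra v0 => /eqP /(balanced_eq0 u0 dual uv) ->.
  - exists (u ∘ lunit U), q; rewrite compA -e -(compA (_ ⊗₁ v)) lunitK.
    by rewrite comp_idr.
  have [p /fin_all_exists[q' hE]] := fin_all_exists hf.
  have hS : v = \sum_i q' i ∘ p i by rewrite vE; apply: eq_bigr => i _; exact: hE.
  rewrite hS in uv *; exact: (balanced_sum_factors u0 dual uv).
exists w; split=> // w' w'u; apply/eqP; rewrite -subr_eq0; apply/eqP.
apply: (comp_tunit_eq0 u0).
by rewrite (bilBl (comp_bilinear _ _ _)) w'u vE subrr.
Qed.

End Slices.

(** * Linear functionals, and slices from (Ex1) *)

Section ScalarMaps.
Variables (k : fieldType) (M : lmodType k) (δ : M -> k) (δlin : scalar δ).

Lemma scalar0 : δ 0 = 0. Proof. exact: (@lin0 k M k^o δ δlin). Qed.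

Lemma scalarZ a x : δ (a *: x) = a * δ x.
Proof. exact: (@linZ k M k^o δ δlin). Qed.

Lemma scalar_sum (I : Type) (r : seq I) (F : I -> M) :
  δ (\sum_(i <- r) F i) = \sum_(i <- r) δ (F i).
Proof. exact: (@linsum k M k^o δ δlin). Qed.

End ScalarMaps.

Section Functionals.
Variables (k : fieldType) (M : lmodType k).

(** The space is the direct sum of [N] and the line through [p], and [δ] reads off the coefficient
    of [p]. *)
Lemma complement_functional (N : M -> Prop) (p : M) :
  N 0 -> (forall a x y, N x -> N y -> N (a *: x + y)) -> ~ N p ->
  (forall x, exists c, N (x - c *: p)) ->
  exists δ : M -> k, [/\ scalar δ, δ p = 1 & forall x, N x -> δ x = 0].
Proof.
move=> N0 Nlin Np cover.
have N_unique c c' x : N (x - c *: p) -> N (x - c' *: p) -> c = c'.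
  move=> Nc Nc'; apply/eqP; rewrite -subr_eq0; apply/negP => /negP cc'.
  apply: Np; have := Nlin (c' - c)^-1 _ _ (Nlin (-1) _ _ Nc' Nc) N0.
  rewrite addr0 scaleN1r opprB addrA subrK -scalerBl scalerA mulVf ?scale1r //.
  by rewrite -opprB oppr_eq0.
pose δ x := projT1 (cid (cover x)).
have Nδ x : N (x - δ x *: p) by rewrite /δ; case: (cid _).
exists δ; split=> [a x y||x Nx].
- apply: (N_unique _ _ (a *: x + y)) => //.
  have := Nlin a _ _ (Nδ x) (Nδ y).
  by rewrite scalerBr scalerA addrACA -opprD -scalerDl.
- by apply: (N_unique _ _ p) => //; rewrite scale1r subrr.
- by apply: (N_unique _ _ x) => //; rewrite scale0r subr0.
Qed.

(** Zorn's lemma gives a maximal subspace [N] avoiding [p]. For [x] outside [N], the span of [N] and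
    [x] contains [p], so [N] is a complement of the line through [p]. *)
Lemma separating_functional (p : M) : p != 0 ->
  exists δ : M -> k, scalar δ /\ δ p = 1.
Proof.
move=> p0.
pose P (N : set M) := (forall a x y, N x -> N y -> N (a *: x + y)) /\ ~ N p.
have [F FP Ftot|N [[Nlin Np] Nmax]] := @Zorn_bigcup M P.
  split=> [a x y [X FX Xx] [Y FY Yy]|[X FX Xp]]; last by case: (FP X FX).
  have [XY|YX] := Ftot X Y FX FY.
    by exists Y => //; apply: (FP Y FY).1 => //; exact: XY.
  by exists X => //; apply: (FP X FX).1 => //; exact: YX.
(* The predicate [P] admits the empty set, the union of the empty chain; maximality against the zero
   subspace excludes it. *)
have N0 : N 0.
  apply: contrapT => N0; have Z0 : (N `<` [set 0])%classic.
    split=> [x Nx|/(_ 0 erefl)//].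
    by case: N0; have := Nlin (-1) _ _ Nx Nx; rewrite scaleN1r addNr.
  apply: (Nmax _ Z0); split=> [a x y -> ->|/eqP]; first by rewrite scaler0 addr0.
  by rewrite (negbTE p0).
have [|δ [δlin δp _]] := complement_functional N0 Nlin Np; last by exists δ.
move=> x; have [Nx|Nx] := pselect (N x).
  by exists 0; rewrite scale0r subr0.
pose N' (y : M) := exists a, N (y - a *: x).
have [a Na] : N' p.
  apply: contrapT => N'p; have NN' : (N `<` N')%classic.
    split=> [y Ny|sub]; first by exists 0; rewrite scale0r subr0.
    by apply/Nx/sub; exists 1; rewrite scale1r subrr.
  apply: (Nmax _ NN'); split=> // a y z [c Nc] [d Nd]; exists (a * c + d).
  by rewrite scalerDl -scalerA opprD addrACA -scalerBr; exact: Nlin.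
have a0 : a != 0.
  by apply/negP => /eqP a0; move: Na; rewrite a0 scale0r subr0.
exists a^-1; have := Nlin (- a^-1) _ _ Na N0.
by rewrite addr0 scaleNr scalerBr scalerA mulVf // scale1r opprB.
Qed.

End Functionals.

(** The bilinear map [(f, g) |-> δ g *: f] extends to the tensor product, where by injectivity every
    linear relation between composites already holds. *)
Lemma Ex1_slices (k : fieldType) (C : monCat k) : Ex1 C -> has_slices C.
Proof.
move=> ex1 U p /separating_functional[δ [δlin δp]].
exists δ; split=> [|V n q r qr0]; first by rewrite δp oner_neq0.
have [T [t [φ [[tbil univ] φlin φt φinj]]]] := ex1 U V.
have [|ψ [ψlin ψt _]] := univ _ (fun (f : Hom 𝟙 V) g => δ g *: f).
  split=> [f a g h|g a f h] /=.
    by rewrite (δlin a g h) scalerDl scalerA.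
  by rewrite scalerDr !scalerA mulrC.
have t0 : \sum_i t (q i) (r i) = 0.
  apply: φinj; rewrite (linsum φlin) (lin0 φlin) -[RHS]qr0.
  by apply: eq_bigr => i _; rewrite φt comp_tunitE.
rewrite -[RHS](lin0 ψlin) -t0 (linsum ψlin).
by apply: eq_bigr => i _; rewrite ψt.
Qed.

(** * Coordinate functionals of bases *)

Section Coordinates.
Variables (k : fieldType) (M : lmodType k) (B : M -> Prop).
Hypothesis basisB : is_basis B.

Definition coordinate (b : M) (δ : M -> k) : Prop :=
  [/\ scalar δ, δ b = 1 & forall b', B b' -> b' != b -> δ b' = 0].

Lemma basis_free_seq (s : seq M) (c : M -> k) :
  uniq s -> (forall y, y \in s -> B y) ->
  \sum_(y <- s) c y *: y = 0 -> forall y, y \in s -> c y = 0.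
Proof.
move=> us sB; rewrite (big_nth 0) big_mkord => sum0 y ys.
have lt_y : (index y s < size s)%N by rewrite index_mem.
have := basisB.1 _ (fun i : 'I_(size s) => nth 0 s i) (fun i => c (nth 0 s i)).
move=> /(_ _ _ sum0 (Ordinal lt_y)) /=; rewrite nth_index //; apply.
  by move=> i j /eqP; rewrite nth_uniq // => /eqP/val_inj.
by move=> i; apply/sB/mem_nth.
Qed.

(** Collects the coefficients of equal vectors: spanning families in [is_basis] may repeat vectors,
    while freeness concerns injective ones. *)
Lemma combination_undup (s : seq (k * M)) :
  \sum_(x <- s) x.1 *: x.2 =
  \sum_(y <- undup (map snd s)) (\sum_(x <- s | x.2 == y) x.1) *: y.
Proof.
under [RHS]eq_bigr do rewrite scaler_suml big_mkcond /=.
rewrite exchange_big /=; apply: eq_big_seq => x xs.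
rewrite (bigD1_seq x.2) ?undup_uniq ?mem_undup ?map_f //= eqxx big1 ?addr0 //.
by move=> y /negbTE; rewrite eq_sym => ->.
Qed.

Lemma basis_expand (m : M) : exists (s : seq M) (c : M -> k),
  [/\ uniq s, forall y, y \in s -> B y & m = \sum_(y <- s) c y *: y].
Proof.
have [n [e [c [eB ->]]]] := basisB.2 m.
have := combination_undup [seq (c i, e i) | i <- enum 'I_n].
rewrite big_map big_enum => ->; eexists _, _; split; last reflexivity.
  exact: undup_uniq.
by move=> y; rewrite mem_undup => /mapP[_ /mapP[i _ ->] ->]; exact: eB.
Qed.

Lemma coordinate_exists (b : M) : B b -> exists δ, coordinate b δ.
Proof.
move=> Bb.
(* The span of the other basis vectors, a complement of the line through [b]. *)
pose N m := exists s : seq (k * M),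
  (forall x, x \in s -> B x.2 /\ x.2 != b) /\ m = \sum_(x <- s) x.1 *: x.2.
have [|||m|δ [δlin δb δN]] := @complement_functional k M N b.
- by exists [::]; rewrite big_nil.
- move=> a x y [s [sB ->]] [t [tB ->]].
  exists ([seq (a * z.1, z.2) | z <- s] ++ t); split=> [z|].
    by rewrite mem_cat => /orP[/mapP[z' /sB z'B ->]|/tB].
  rewrite big_cat big_map /= scaler_sumr; congr (_ + _).
  by apply: eq_bigr => z _; rewrite scalerA.
- case=> s [sB]; rewrite combination_undup; set t := undup _; move=> bE.
  pose c y := \sum_(x <- s | x.2 == y) x.1.
  have tB y : y \in t -> B y /\ y != b.
    by rewrite mem_undup => /mapP[x /sB xB ->].
  have b_t : b \notin t by apply/negP => /tB[_]; rewrite eqxx.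
  (* Coefficient [-1] at [b] turns an expression of [b] by the other vectors into a non-trivial
     relation. *)
  pose c' y := if y == b then -1 else c y.
  have c'b : c' b = -1 by rewrite /c' eqxx.
  have ubt : uniq (b :: t) by rewrite /= b_t undup_uniq.
  have btB y : y \in b :: t -> B y by rewrite inE => /orP[/eqP->|/tB[]].
  suff sum0 : \sum_(y <- b :: t) c' y *: y = 0.
    have /eqP := basis_free_seq ubt btB sum0 (mem_head b t).
    by rewrite c'b oppr_eq0 oner_eq0.
  rewrite big_cons c'b scaleN1r addrC; apply/eqP; rewrite subr_eq0; apply/eqP.
  rewrite [RHS]bE; apply: eq_big_seq => y /tB[_ /negbTE yb].
  by rewrite /c' yb.
- have [s [c [us sB ->]]] := basis_expand m.
  exists (if b \in s then c b else 0); exists [seq (c y, y) | y <- s & y != b].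
  split=> [x /mapP[y]|].
    by rewrite mem_filter => /andP[yb /sB yB] ->.
  rewrite big_map big_filter /=; case: ifP => bs.
    by rewrite (bigD1_seq b) //= addrC addrK.
  rewrite scale0r subr0 [RHS]big_mkcond; apply: eq_big_seq => y ys.
  by case: eqP => // yb; rewrite -yb ys in bs.
exists δ; split=> // b' Bb' b'b; apply: δN; exists [:: (1, b')].
by rewrite big_seq1 scale1r; split=> // x; rewrite inE => /eqP ->.
Qed.

Lemma coordinate_expand (b : M) (δ : M -> k) (s : seq M) (c : M -> k) :
  coordinate b δ -> uniq s -> (forall y, y \in s -> B y) ->
  δ (\sum_(y <- s) c y *: y) = if b \in s then c b else 0.
Proof.
move=> [δlin δb δ0] us sB; rewrite (scalar_sum δlin); case: ifP => bs.
  rewrite (bigD1_seq b) //= (scalarZ δlin) δb mulr1 big_seq_cond big1 ?addr0 //.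
  by move=> y /andP[/sB yB yb]; rewrite (scalarZ δlin) δ0 // mulr0.
rewrite big_seq big1 // => y ys; rewrite (scalarZ δlin) δ0 ?mulr0 //.
  exact: sB.
by apply/eqP => yb; rewrite -yb ys in bs.
Qed.

Lemma coordinate_neq0 (m : M) : m != 0 ->
  exists b δ, [/\ B b, coordinate b δ & δ m != 0].
Proof.
have [s [c [us sB ->]]] := basis_expand m => m0.
have [/hasP[b bs cb]|/hasPn c0] := boolP (has (fun y => c y != 0) s); last first.
  case/eqP: m0; rewrite big_seq big1 // => y /c0.
  by rewrite negbK => /eqP ->; rewrite scale0r.
have [δ δb] := coordinate_exists (sB b bs).
by exists b, δ; split; [exact: sB|by []|rewrite (coordinate_expand _ δb) // bs].
Qed.

End Coordinates.

Section CoordinatesOfProducts.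
Variables (k : fieldType) (M1 M2 M3 : lmodType k) (β : M1 -> M2 -> M3).
Variables (B1 : M1 -> Prop) (B2 : M2 -> Prop) (B3 : M3 -> Prop).
Hypotheses (basis1 : is_basis B1) (basis2 : is_basis B2) (bilβ : bilinear_map β).
Hypothesis βB : forall x y, B1 x -> B2 y -> B3 (β x y).
Hypothesis βinj : forall x y x' y', B1 x -> B2 y -> B1 x' -> B2 y' ->
  β x y = β x' y' -> x = x' /\ y = y'.

(** By bilinearity it suffices to compare on basis vectors, where injectivity of [β] makes both
    sides the indicator of the pair [(b1, b2)]. *)
Lemma coordinate_bilinear b1 b2 δ1 δ2 δ3 x y : B1 b1 -> B2 b2 ->
  coordinate B1 b1 δ1 -> coordinate B2 b2 δ2 -> coordinate B3 (β b1 b2) δ3 ->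
  δ3 (β x y) = δ1 x * δ2 y.
Proof.
move=> B1b B2b [δ1lin δ1b δ10] [δ2lin δ2b δ20] [δ3lin δ3b δ30].
have [s [c [_ sB ->]]] := basis_expand basis1 x.
have [t [d [_ tB ->]]] := basis_expand basis2 y.
rewrite (scalar_sum δ1lin) (scalar_sum δ2lin) big_distrl (bilsuml bilβ).
rewrite (scalar_sum δ3lin).
apply: eq_big_seq => b1' /sB B1b'; rewrite (bilZl bilβ) /=.
rewrite (scalarZ δ3lin) (scalarZ δ1lin) -mulrA; congr (_ * _).
rewrite big_distrr (bilsumr bilβ) (scalar_sum δ3lin).
apply: eq_big_seq => b2' /tB B2b'; rewrite (bilZr bilβ) /=.
rewrite (scalarZ δ3lin) (scalarZ δ2lin) mulrCA; congr (_ * _).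
have [->|ne1] := eqVneq b1' b1; last first.
  rewrite δ10 // mul0r δ30 //; first exact: βB.
  by apply: contra ne1 => /eqP /βinj[] // ->.
have [->|ne2] := eqVneq b2' b2; first by rewrite δ1b δ2b δ3b mulr1.
rewrite δ20 // mulr0 δ30 //; first exact: βB.
by apply: contra ne2 => /eqP /βinj[] // _ ->.
Qed.

End CoordinatesOfProducts.

(** * Sums of morphisms factoring through the unit *)

Section FactorizationSums.
Variables (k : fieldType) (C : monCat k).

Lemma sum_of_factors0 (X Y : C) : sum_of_factors_through_unit (0 : Hom X Y).
Proof. by exists 0, (fun=> 0); split; [case|rewrite big_ord0]. Qed.

Lemma sum_of_factors_factor (X Y : C) (f : Hom X Y) :
  factors_through_unit f -> sum_of_factors_through_unit f.
Proof. by exists 1, (fun=> f); rewrite big_ord1. Qed.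

Lemma sum_of_factorsD (X Y : C) (f g : Hom X Y) :
  sum_of_factors_through_unit f -> sum_of_factors_through_unit g ->
  sum_of_factors_through_unit (f + g).
Proof.
move=> [m [f' [f'P ->]]] [n [g' [g'P ->]]].
exists (m + n)%N, (fun i => match split i with inl a => f' a | inr b => g' b end).
split=> [i|]; first by case: (split i).
rewrite big_split_ord; congr (_ + _); apply: eq_bigr => i _.
  by have := unsplitK (inl i : 'I_m + 'I_n) => /= ->.
by have := unsplitK (inr i : 'I_m + 'I_n) => /= ->.
Qed.

Lemma sum_of_factors_sum (X Y : C) (I : eqType) (s : seq I) (F : I -> Hom X Y) :
  (forall i, i \in s -> sum_of_factors_through_unit (F i)) ->
  sum_of_factors_through_unit (\sum_(i <- s) F i).
Proof.
move=> FP; rewrite big_seq; apply: big_ind FP; first exact: sum_of_factors0.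
exact: sum_of_factorsD.
Qed.

Lemma factorsZ (X Y : C) a (f : Hom X Y) :
  factors_through_unit f -> factors_through_unit (a *: f).
Proof.
by move=> [p [q ->]]; exists p, (a *: q); rewrite (bilZl (comp_bilinear _ _ _)).
Qed.

Lemma factors_comp (X Y X' Y' : C) (f : Hom X Y) (b : Hom X' X) (a : Hom Y Y') :
  factors_through_unit f -> factors_through_unit (a ∘ f ∘ b).
Proof. by move=> [p [q ->]]; exists (p ∘ b), (a ∘ q); rewrite !compA. Qed.

Lemma sum_of_factors_comp (X Y X' Y' : C) (f : Hom X Y) (b : Hom X' X)
    (a : Hom Y Y') :
  sum_of_factors_through_unit f -> sum_of_factors_through_unit (a ∘ f ∘ b).
Proof.
move=> [n [h [hP ->]]]; exists n, (fun i => a ∘ h i ∘ b); split=> [i|].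
  exact: factors_comp.
rewrite (bilsumr (comp_bilinear _ _ _)) (bilsuml (comp_bilinear _ _ _)).
by [].
Qed.

End FactorizationSums.

(* Unlike [Ex2], this allows [f ⊗ g = 0], so that it passes to summands, where
   the components of a non-zero tensor product may vanish. *)
Definition tensor_splits (k : fieldType) (C : monCat k) : Prop :=
  forall (U V U' V' : C) (f : Hom U V) (g : Hom U' V'),
    f != 0 -> factors_through_unit (f ⊗₁ g) -> sum_of_factors_through_unit g.

(** * Slices and splitting in pseudo-diagrammatic categories *)

Section PseudoDiagrammatic.
Variables (k : fieldType) (C : monCat k).

Lemma comp_tensE (X Y : C) (b : Hom 𝟙 Y) (c : Hom X 𝟙) :
  runit_inv Y ∘ (b ∘ c) ∘ lunit X = b ⊗₁ c.
Proof. by rewrite -comp_tunitE -!compA lunitK comp_idr !compA runitK comp_idl. Qed.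

Lemma unit_compatible_comp (B : forall X Y : C, Hom X Y -> Prop) :
  unit_compatible B ->
  (forall (U V U' V' : C) (b : Hom U V) (b' : Hom U' V'),
     B _ _ b -> B _ _ b' -> B _ _ (b ⊗₁ b')) ->
  forall (X Y : C) (b : Hom 𝟙 Y) (c : Hom X 𝟙),
    B _ _ b -> B _ _ c -> B _ _ (b ∘ c).
Proof.
move=> Bunit tensB X Y b c Bb Bc.
have [_ _ _ runitB] := Bunit _ _ (b ∘ c).
have [lunitB _ _ _] := Bunit _ _ (runit_inv Y ∘ (b ∘ c)).
by apply/runitB/lunitB; rewrite comp_tensE; exact: tensB.
Qed.

Hypothesis pdC : pseudo_diagrammatic C.

(** For [δ] the coordinate at a basis element [c], the coordinate at [b] of a slice is the
    coordinate at [b ∘ c] of the sliced sum. *)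
Lemma pseudo_diagrammatic_slices : has_slices C.
Proof.
have [B [basisB Bunit tensB tens_inj _]] := pdC.
have compB X Y := @unit_compatible_comp B Bunit tensB X Y.
have comp_inj X Y (b b' : Hom 𝟙 Y) (c c' : Hom X 𝟙) :
    B _ _ b -> B _ _ c -> B _ _ b' -> B _ _ c' ->
    b ∘ c = b' ∘ c' -> b = b' /\ c = c'.
  move=> Bb Bc Bb' Bc' e; apply: tens_inj => //.
  by rewrite -!comp_tensE e.
move=> U p /(coordinate_neq0 (basisB U 𝟙))[c [δ [Bc cδ δp]]].
exists δ; split=> // V n q r qr0.
apply/eqP/negPn/negP => /(coordinate_neq0 (basisB 𝟙 V))[b [δ' [Bb bδ']]].
have [ε bcε] := coordinate_exists (basisB U V) (compB _ _ _ _ Bb Bc).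
have [δ'lin _ _] := bδ'; have [εlin _ _] := bcε.
case/eqP; rewrite (scalar_sum δ'lin).
rewrite -[RHS](scalar0 εlin) -qr0 (scalar_sum εlin).
apply: eq_bigr => i _; rewrite (scalarZ δ'lin) [LHS]mulrC.
rewrite (coordinate_bilinear (basisB 𝟙 V) (basisB U 𝟙) (comp_bilinear _ _ _)
  (compB U V) (fun x y x' y' => @comp_inj U V x x' y y') _ _ Bb Bc bδ' cδ bcε).
by [].
Qed.

(** Fix [b] occurring in [f]. For each [c] occurring in [g], [b ⊗ c] occurs in [f ⊗ g], so it
    factors through [𝟙], and hence so does [c]. *)
Lemma pseudo_diagrammatic_splits : tensor_splits C.
Proof.
have [B [basisB Bunit tensB tens_inj tens_factor]] := pdC.
have compB X Y := @unit_compatible_comp B Bunit tensB X Y.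
move=> U V U' V' f g /(coordinate_neq0 (basisB U V))[b [δ [Bb bδ δf]]] [p [q fgE]].
have [t [d [ut tB gE]]] := basis_expand (basisB U' V') g.
rewrite gE; apply: sum_of_factors_sum => c ct.
have [->|dc] := eqVneq (d c) 0; first by rewrite scale0r; exact: sum_of_factors0.
apply/sum_of_factors_factor/factorsZ.
have Bc := tB c ct.
have [δ' cδ'] := coordinate_exists (basisB U' V') Bc.
have [ε bcε] := coordinate_exists (basisB _ _) (tensB _ _ _ _ _ _ Bb Bc).
have εfg : ε (f ⊗₁ g) != 0.
  rewrite (coordinate_bilinear (basisB U V) (basisB U' V') (tensm_bilinear _ _ _ _)
    (tensB _ _ _ _) (fun x y x' y' Bx By Bx' By' =>
                       tens_inj _ _ _ _ x x' y y' Bx Bx' By By')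
    _ _ Bb Bc bδ cδ' bcε).
  by rewrite mulf_neq0 // gE (coordinate_expand _ cδ' ut tB) ct.
suff : factors_through_unit (b ⊗₁ c) by case/(tens_factor _ _ _ _ _ _ Bb Bc).
(* Expanding [q] and [p] writes [q ∘ p] in basis elements that factor through [𝟙]; if [b ⊗ c] is
   none of them, its coordinate vanishes. *)
apply: contrapT => nfact; case/eqP: εfg; rewrite fgE.
have [εlin _ ε0] := bcε.
have [s1 [c1 [_ s1B ->]]] := basis_expand (basisB _ _) q.
have [s2 [c2 [_ s2B ->]]] := basis_expand (basisB _ _) p.
rewrite (bilsuml (comp_bilinear _ _ _)) (scalar_sum εlin) big_seq big1 // => x xs.
rewrite (bilsumr (comp_bilinear _ _ _)) (scalar_sum εlin) big_seq big1 // => y ys.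
rewrite (bilZl (comp_bilinear _ _ _)) (bilZr (comp_bilinear _ _ _)).
rewrite !(scalarZ εlin) ε0; first by rewrite !mulr0.
  by apply: compB; [exact: s1B|exact: s2B].
by apply/eqP => e; apply: nfact; exists y, x.
Qed.

End PseudoDiagrammatic.

(** * Passage from a full subcategory to direct summands of sums *)

Section FullSubcategoryRetracts.
Variables (k : fieldType) (C : monCat k) (P : C -> Prop) (P1 : P 𝟙)
  (Pt : forall X Y, P X -> P Y -> P (X ⊗₀ Y)).
Let D := full_monoidal_subcat P P1 Pt.
Hypothesis retract : forall X : C, exists (n : nat) (Y : 'I_n -> C)
  (a : forall i, Hom X (Y i)) (b : forall i, Hom (Y i) X),
  (forall i, P (Y i)) /\ \sum_i (b i ∘ a i) = idm X.

Lemma retract_comp_neq0 (X Z : C) (f : Hom X Z) : f != 0 ->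
  exists (Y : C) (b : Hom Y X), P Y /\ f ∘ b != 0.
Proof.
move=> f0; apply: contrapT => nex; case/eqP: f0.
have [n [Y [a [b [PY e]]]]] := retract X.
rewrite -[f]comp_idr -e (bilsumr (comp_bilinear _ _ _)) big1 // => i _.
rewrite compA; have [->|fb] := eqVneq (f ∘ b i) 0.
  by rewrite (bil0l (comp_bilinear _ _ _)).
by case: nex; exists (Y i), (b i).
Qed.

Lemma retract_comp_eq0 (X Z : C) (f : Hom Z X) :
  (forall (Y : C) (a : Hom X Y), P Y -> a ∘ f = 0) -> f = 0.
Proof.
move=> f0; have [n [Y [a [b [PY e]]]]] := retract X.
rewrite -[f]comp_idl -e (bilsuml (comp_bilinear _ _ _)) big1 // => i _.
by rewrite -compA f0 // (bil0r (comp_bilinear _ _ _)).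
Qed.

(** A functional for some non-zero [p ∘ b] is pulled back along [b]; vanishing of a slice is tested
    after composing with maps into objects of [P]. *)
Lemma full_subcat_slices : has_slices D -> has_slices C.
Proof.
move=> slices U p /retract_comp_neq0[Y [b [PY pb]]].
have [δ [δpb hδ]] := slices (exist P Y PY) _ pb.
exists (fun p => δ (p ∘ b)); split=> // V n q r qr0.
apply: retract_comp_eq0 => Z a PZ.
have := hδ (exist P Z PZ) n (fun i => a ∘ q i) (fun i => r i ∘ b).
rewrite (bilsumr (comp_bilinear _ _ _)) => h; rewrite -[RHS]h.
  by apply: eq_bigr => i _; rewrite (bilZr (comp_bilinear _ _ _)).
transitivity (a ∘ (\sum_i q i ∘ r i) ∘ b); last first.
  by rewrite qr0 (bil0r (comp_bilinear _ _ _)) (bil0l (comp_bilinear _ _ _)).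
rewrite (bilsumr (comp_bilinear _ _ _)) (bilsuml (comp_bilinear _ _ _)).
by apply: eq_bigr => i _; rewrite /= !compA.
Qed.

(** One non-zero component of [f] is paired with every component of [g]; the components of [g] then
    reassemble to [g]. *)
Lemma full_subcat_splits : tensor_splits D -> tensor_splits C.
Proof.
move=> splits U V U' V' f g f0 fg.
have [Y [b [PY fb0]]] := retract_comp_neq0 f0.
have [Z [a [PZ afb0]]] : exists (Z : C) (a : Hom V Z), P Z /\ a ∘ (f ∘ b) != 0.
  apply: contrapT => nex; case/eqP: fb0; apply: retract_comp_eq0 => Z a PZ.
  by apply/eqP/negPn/negP => h; apply: nex; exists Z, a.
have [m [Y' [a1 [b1 [PY' e1]]]]] := retract U'.
have [n [Z' [a2 [b2 [PZ' e2]]]]] := retract V'.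
have -> : g = \sum_j \sum_i b2 j ∘ (a2 j ∘ g ∘ b1 i) ∘ a1 i.
  rewrite -[LHS]comp_idl -e2 (bilsuml (comp_bilinear _ _ _)).
  apply: eq_bigr => j _; rewrite -[LHS]comp_idr -e1 (bilsumr (comp_bilinear _ _ _)).
  by apply: eq_bigr => i _; rewrite !compA.
do 2![apply: sum_of_factors_sum => ? _]; apply: sum_of_factors_comp.
apply: (splits (exist P Y PY) (exist P Z PZ) (exist P _ (PY' _))
  (exist P _ (PZ' _)) _ _ afb0).
by rewrite /= compA !tensm_comp; exact: (factors_comp (C:=C)).
Qed.

Lemma full_subcat_U_eq_Uex : rigid C -> pseudo_diagrammatic D -> U_eq_Uex C.
Proof.
move=> rC pdD; apply: U_eq_Uex_of_slices => //.
  exact/full_subcat_slices/pseudo_diagrammatic_slices.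
move=> U V U' V' f g fg.
apply: (full_subcat_splits (pseudo_diagrammatic_splits pdD)).
by apply: contra fg => /eqP ->; rewrite (bil0l (tensm_bilinear _ _ _ _)).
Qed.

End FullSubcategoryRetracts.

Theorem proposition3p10 (k : fieldType) (C : monCat k) (hC : rigid C) :
  (Ex1 C -> Ex2 C -> U_eq_Uex C) /\
  (pseudo_diagrammatic C -> U_eq_Uex C) /\
  (oplus_pseudo_diagrammatic C -> U_eq_Uex C).
Proof.
split=> [ex1 ex2|].
  apply: U_eq_Uex_of_slices => //; first exact: Ex1_slices.
  by move=> U V U' V' f g fg /(ex2 _ _ _ _ _ _ fg)[].
split=> [[B [basisB Bunit tensB tens_inj tens_factor]]
        |[P [P1 [Pt [pdD summands]]]]].
  (* The category is treated as the full subcategory of all its objects. *)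
  apply: (@full_subcat_U_eq_Uex k C (fun=> True) I (fun _ _ _ _ => I)) => //.
    move=> X; exists 1, (fun=> X), (fun=> idm X), (fun=> idm X).
    by rewrite big_ord1 comp_idl.
  exists (fun X Y f => B (sval X) (sval Y) f); split=> X Y.
  - exact: basisB.
  - exact: (Bunit (sval X) (sval Y)).
  - by move=> X' Y'; exact: (tensB (sval X) (sval Y) (sval X') (sval Y')).
  - by move=> X' Y'; exact: (tens_inj (sval X) (sval Y) (sval X') (sval Y')).
  - by move=> X' Y'; exact: (tens_factor (sval X) (sval Y) (sval X') (sval Y')).
apply: (full_subcat_U_eq_Uex _ hC pdD) => X.
have [n [Y [S [PY [i [r [_ _ sumS]]] [X' [i' [r' [ri' _ _]]]]]]]] := summands X.
(* The identity of [X] passes through [S], whose identity splits over the [Y j]; the index [true]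
   marks the summand [X]. *)
exists n, Y, (fun j => r j ∘ i' true), (fun j => r' true ∘ i j); split=> //.
rewrite -(ri' true) -[X in X ∘ i' true]comp_idr -sumS.
rewrite (bilsumr (comp_bilinear _ _ _)) (bilsuml (comp_bilinear _ _ _)).
by apply: eq_bigr => j _; rewrite !compA.
Qed.
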